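(* Let $T_t=\sum_{i=0}^{+\infty}\mathfrak{T}_it^i$ be a formal deformation of a relative Rota-Baxter operator $T:V\to\mathfrak{L}$ on a Leibniz triple system $(\mathfrak{L},\{\cdot,\cdot,\cdot\})$ with respect to a representation $(r,m,l)$ of $\mathfrak{L}$ on $V$. Then $\mathfrak{T}_1$ is a $1$-cocycle for the relative Rota-Baxter operator $T$, that is, $\partial^1\mathfrak{T}_1=0$.
   Context: All vector spaces are over a fixed arbitrary field $\mathbb{F}$. A Leibniz triple system is a vector space $\mathfrak{L}$ with a trilinear operation $\{\cdot,\cdot,\cdot\}:\mathfrak{L}\times\mathfrak{L}\times\mathfrak{L}\to\mathfrak{L}$ such that for all $a,b,c,d,e\in\mathfrak{L}$: $\{a,b,\{c,d,e\}\}=\{\{a,b,c\},d,e\}-\{\{a,b,d\},c,e\}-\{\{a,b,e\},c,d\}+\{\{a,b,e\},d,c\}$ and $\{a,\{b,c,d\},e\}=\{\{a,b,c\},d,e\}-\{\{a,c,b\},d,e\}-\{\{a,d,b\},c,e\}+\{\{a,d,c\},b,e\}$. A representation of $\mathfrak{L}$ on a vector space $V$ is a triple $(r,m,l)$ of bilinear maps $l,m,r:\mathfrak{L}\times\mathfrak{L}\to\mathrm{End}(V)$ such that for all $a,b,c,d\in\mathfrak{L}$: $l(a,\{b,c,d\})=l(\{a,b,c\},d)-l(\{a,c,b\},d)-l(\{a,d,b\},c)+l(\{a,d,c\},b)$; $m(a,d)l(b,c)=m(\{a,b,c\},d)-m(\{a,c,b\},d)-r(c,d)m(a,b)+r(b,d)m(a,c)$;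 $m(a,d)m(b,c)=r(c,d)l(a,b)-r(c,d)m(a,b)-m(\{a,c,b\},d)+r(b,d)l(a,c)$; $m(a,d)r(b,c)=r(c,d)m(a,b)-r(c,d)l(a,b)-r(b,d)l(a,c)+m(\{a,c,b\},d)$; $r(\{a,b,c\},d)=r(c,d)r(a,b)-r(c,d)r(b,a)-r(b,d)r(c,a)+r(a,d)r(c,b)$; $l(a,b)l(c,d)=l(\{a,b,c\},d)-l(\{a,b,d\},c)-r(c,d)l(a,b)+r(d,c)l(a,b)$; $l(a,b)m(c,d)=m(\{a,b,c\},d)-r(c,d)l(a,b)-l(\{a,b,d\},c)+m(\{a,b,d\},c)$; $l(a,b)r(c,d)=r(c,d)l(a,b)-m(\{a,b,c\},d)-m(\{a,b,d\},c)+l(\{a,b,d\},c)$; $m(a,\{b,c,d\})=r(c,d)m(a,b)-r(b,d)m(a,c)-r(b,c)m(a,d)+r(c,b)m(a,d)$; $r(a,\{b,c,d\})=r(c,d)r(a,b)-r(b,d)r(a,c)-r(b,c)r(a,d)+r(c,b)r(a,d)$. A relative Rota-Baxter operator on $(\mathfrak{L},\{\cdot,\cdot,\cdot\})$ with respect to $(r,m,l)$ is a linear map $T:V\to\mathfrak{L}$ with $\{Tu,Tv,Tw\}=T\big(l(Tu,Tv)w+m(Tu,Tw)v+r(Tv,Tw)u\big)$ for all $u,v,w\in V$. For a linear map $f:V\to\mathfrak{L}$ (a $1$-cochain for $T$), $\partial^1f$ is the trilinear map $\partial^1f(v_1,v_2,v_3)=\{f(v_1),Tv_2,Tv_3\}-T\big(l(f(v_1),Tv_2)v_3+m(f(v_1),Tv_3)v_2\big)+\{Tv_1,f(v_2),Tv_3\}-T\big(l(Tv_1,f(v_2))v_3+r(f(v_2),Tv_3)v_1\big)+\{Tv_1,Tv_2,f(v_3)\}-T\big(m(Tv_1,f(v_3))v_2+r(Tv_2,f(v_3))v_1\big)-f\big(l(Tv_1,Tv_2)v_3+m(Tv_1,Tv_3)v_2+r(Tv_2,Tv_3)v_1\big)$.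 The ternary product of $\mathfrak{L}$ and the maps $l,m,r$ are extended $t$-adically and $\mathbb{F}[[t]]$-multilinearly to $\mathfrak{L}[[t]]$ and $V[[t]]$ (e.g. $\{\sum x_it^i,\sum y_jt^j,\sum z_kt^k\}=\sum_s\sum_{i+j+k=s}\{x_i,y_j,z_k\}t^s$, and similarly for $l,m,r$). A formal deformation of $T$ is a power series $T_t=\sum_{i\ge0}\mathfrak{T}_it^i$ with $\mathfrak{T}_i\in\mathrm{Hom}_{\mathbb{F}}(V,\mathfrak{L})$, $\mathfrak{T}_0=T$, extended to an $\mathbb{F}[[t]]$-module map $V[[t]]\to\mathfrak{L}[[t]]$, such that $\{T_t(u),T_t(v),T_t(w)\}=T_t\big(l(T_t(u),T_t(v))w+m(T_t(u),T_t(w))v+r(T_t(v),T_t(w))u\big)$ for all $u,v,w\in V$. *)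

(* Defs.v *)
From mathcomp Require Import all_boot all_order all_algebra.
Set Implicit Arguments.
Unset Strict Implicit.
Unset Printing Implicit Defensive.
Import GRing.Theory.
Local Open Scope ring_scope.

Definition trilinear (F : fieldType) (X Y Z W : lmodType F)
    (f : X -> Y -> Z -> W) : Prop :=
  [/\ forall y z, linear (fun x => f x y z),
      forall x z, linear (fun y => f x y z)
    & forall x y, linear (f x y)].

Definition leibniz_triple_system (F : fieldType) (L : lmodType F)
    (br : L -> L -> L -> L) : Prop :=
  [/\ trilinear br,
      forall a b c d e,
        br a b (br c d e) =
          br (br a b c) d e - br (br a b d) c e
          - br (br a b e) c d + br (br a b e) d c
    & forall a b c d e,
        br a (br b c d) e =
          br (br a b c) d e - br (br a c b) d e
          - br (br a d b) c e + br (br a d c) b e].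

(* A bilinear map L * L -> End(V) is represented by its uncurried form
   L -> L -> V -> V, which is required to be trilinear; products in End(V)
   are composites, and the identities between endomorphisms are evaluated at
   an arbitrary v : V. *)
Definition representation (F : fieldType) (L : lmodType F)
    (br : L -> L -> L -> L) (V : lmodType F)
    (r m l : L -> L -> V -> V) : Prop :=
  [/\ trilinear r, trilinear m, trilinear l &
  forall (a b c d : L) (v : V),
    l a (br b c d) v =
      l (br a b c) d v - l (br a c b) d v - l (br a d b) c v
      + l (br a d c) b v
    /\
    m a d (l b c v) =
      m (br a b c) d v - m (br a c b) d v - r c d (m a b v)
      + r b d (m a c v)
    /\
    m a d (m b c v) =
      r c d (l a b v) - r c d (m a b v) - m (br a c b) d v
      + r b d (l a c v)
    /\
    m a d (r b c v) =
      r c d (m a b v) - r c d (l a b v) - r b d (l a c v)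
      + m (br a c b) d v
    /\
    r (br a b c) d v =
      r c d (r a b v) - r c d (r b a v) - r b d (r c a v)
      + r a d (r c b v)
    /\
    l a b (l c d v) =
      l (br a b c) d v - l (br a b d) c v - r c d (l a b v)
      + r d c (l a b v)
    /\
    l a b (m c d v) =
      m (br a b c) d v - r c d (l a b v) - l (br a b d) c v
      + m (br a b d) c v
    /\
    l a b (r c d v) =
      r c d (l a b v) - m (br a b c) d v - m (br a b d) c v
      + l (br a b d) c v
    /\
    m a (br b c d) v =
      r c d (m a b v) - r b d (m a c v) - r b c (m a d v)
      + r c b (m a d v)
    /\
    r a (br b c d) v =
      r c d (r a b v) - r b d (r a c v) - r b c (r a d v)
      + r c b (r a d v)].

Definition relative_rota_baxter (F : fieldType) (L : lmodType F)
    (br : L -> L -> L -> L) (V : lmodType F)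
    (r m l : L -> L -> V -> V) (T : {linear V -> L}) : Prop :=
  forall u v w : V,
    br (T u) (T v) (T w) =
      T (l (T u) (T v) w + m (T u) (T w) v + r (T v) (T w) u).

Definition coboundary1 (F : fieldType) (L : lmodType F)
    (br : L -> L -> L -> L) (V : lmodType F)
    (r m l : L -> L -> V -> V) (T f : {linear V -> L})
    (v1 v2 v3 : V) : L :=
  br (f v1) (T v2) (T v3) - T (l (f v1) (T v2) v3 + m (f v1) (T v3) v2)
  + br (T v1) (f v2) (T v3) - T (l (T v1) (f v2) v3 + r (f v2) (T v3) v1)
  + br (T v1) (T v2) (f v3) - T (m (T v1) (f v3) v2 + r (T v2) (f v3) v1)
  - f (l (T v1) (T v2) v3 + m (T v1) (T v3) v2 + r (T v2) (T v3) v1).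

Definition cocycle1 (F : fieldType) (L : lmodType F)
    (br : L -> L -> L -> L) (V : lmodType F)
    (r m l : L -> L -> V -> V) (T f : {linear V -> L}) : Prop :=
  forall v1 v2 v3 : V, coboundary1 br r m l T f v1 v2 v3 = 0.

(* An element of U[[t]] is the sequence of its coefficients. *)
Definition fps (U : Type) : Type := nat -> U.

Definition fps_const (F : fieldType) (U : lmodType F) (u : U) : fps U :=
  fun s => if s == 0%N then u else 0.

Definition fps_add (F : fieldType) (U : lmodType F) (x y : fps U) : fps U :=
  fun s => x s + y s.

Definition fps_trilin (F : fieldType) (X Y Z W : lmodType F)
    (f : X -> Y -> Z -> W) (x : fps X) (y : fps Y) (z : fps Z) : fps W :=
  fun s => \sum_(i < s.+1) \sum_(j < s.+1) \sum_(k < s.+1 | (i + j + k == s)%N)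
             f (x i) (y j) (z k).

(* The F[[t]]-module map V[[t]] -> L[[t]] induced by sum_i (Tt i) t^i. *)
Definition fps_map (F : fieldType) (V L : lmodType F)
    (Tt : nat -> {linear V -> L}) (v : fps V) : fps L :=
  fun s => \sum_(i < s.+1) \sum_(j < s.+1 | (i + j == s)%N) Tt i (v j).

Definition formal_deformation (F : fieldType) (L : lmodType F)
    (br : L -> L -> L -> L) (V : lmodType F)
    (r m l : L -> L -> V -> V) (T : {linear V -> L})
    (Tt : nat -> {linear V -> L}) : Prop :=
  Tt 0%N =1 T /\
  forall u v w : V,
    let Tu := fps_map Tt (fps_const u) in
    let Tv := fps_map Tt (fps_const v) in
    let Tw := fps_map Tt (fps_const w) in
    fps_trilin br Tu Tv Tw =1
      fps_map Tt
        (fps_add (fps_add (fps_trilin l Tu Tv (fps_const w))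
                          (fps_trilin m Tu Tw (fps_const v)))
                 (fps_trilin r Tv Tw (fps_const u))).

(* Main.v *)
Require Import Defs.
From mathcomp Require Import all_boot all_order all_algebra.
Import GRing.Theory.
Local Open Scope ring_scope.

(** The cocycle condition is the first-order part of the deformation equation.
    A trilinear product of power series has as coefficient of t the sum of
    three terms, in each of which exactly one factor contributes its
    coefficient of t ([fps_trilin_coef1]); this is the Leibniz rule.  On
    constant vectors the series T_t(u) has coefficients Tt s u, and the vectors
    u, v, w themselves have no t-term.  So the left-hand side of the deformation
    equation gives the three brackets of the coboundary.  On the right, T_t
    applied to a series x contributes T x_1 + Tt_1 x_0 ([fps_map_coef1]): the
    six terms under T are those where one of the two operators inside l, m or r
    is Tt_1, and the term under Tt_1 is the constant term of x.  The difference
    of the two sides is the coboundary of Tt_1. *)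

Section FormalSeries.

Variables (F : fieldType) (X Y Z W : lmodType F).

Lemma fps_trilin_coef0 (f : X -> Y -> Z -> W) (x : fps X) (y : fps Y)
    (z : fps Z) :
  fps_trilin f x y z 0%N = f (x 0%N) (y 0%N) (z 0%N).
Proof. by rewrite /fps_trilin !big_ord1 big_mkcond big_ord1. Qed.

Lemma fps_trilin_coef1 (f : X -> Y -> Z -> W) (x : fps X) (y : fps Y)
    (z : fps Z) :
  fps_trilin f x y z 1%N =
    f (x 1%N) (y 0%N) (z 0%N) + f (x 0%N) (y 1%N) (z 0%N)
    + f (x 0%N) (y 0%N) (z 1%N).
Proof.
rewrite /fps_trilin !big_ord_recl !big_ord0.
rewrite !(big_mkcond (fun k => _ == _)) !big_ord_recl !big_ord0 /=.
by rewrite !(addr0, add0r) [LHS](ACl (3*2*1)).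
Qed.

Lemma fps_map_coef1 (Tt : nat -> {linear X -> Y}) (x : fps X) :
  fps_map Tt x 1%N = Tt 0%N (x 1%N) + Tt 1%N (x 0%N).
Proof.
rewrite /fps_map !big_ord_recl !big_ord0.
rewrite !(big_mkcond (fun k => _ == _)) !big_ord_recl !big_ord0 /=.
by rewrite !(addr0, add0r).
Qed.

Lemma fps_map_const (Tt : nat -> {linear X -> Y}) (u : X) (s : nat) :
  fps_map Tt (fps_const u) s = Tt s u.
Proof.
rewrite /fps_map (bigD1 ord_max) //= big_mkcond big_ord_recl /= addn0 eqxx.
rewrite [X in _ + X + _]big1 => [|i _]; last by rewrite linear0 if_same.
rewrite addr0 big1 ?addr0 // => i i_ne_s.
rewrite big1 // => j /eqP ij_s; rewrite /fps_const.
case: eqP => [j0|_]; last by rewrite linear0.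
by case/eqP: i_ne_s; apply: val_inj; move: ij_s; rewrite j0 addn0.
Qed.

Lemma trilinear_0r (f : X -> Y -> Z -> W) (x : X) (y : Y) :
  trilinear f -> f x y 0 = 0.
Proof.
case=> _ _ /(_ x y 1 0 0); rewrite !scale1r addr0 => /esym.
by rewrite -[RHS]addr0 => /addrI.
Qed.

(** This is the shape of the terms l(T_t u, T_t v)w, m(T_t u, T_t w)v and
    r(T_t v, T_t w)u: the module vector has no t-term, so only the two
    operators are differentiated. *)
Lemma fps_trilin_const_coef1 (f : X -> Y -> Z -> W) (x : fps X) (y : fps Y)
    (w : Z) :
  trilinear f ->
  fps_trilin f x y (fps_const w) 1%N =
    f (x 1%N) (y 0%N) w + f (x 0%N) (y 1%N) w.
Proof. by move=> f_tri; rewrite fps_trilin_coef1 trilinear_0r // addr0. Qed.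

End FormalSeries.

Theorem proposition5p7 (F : fieldType) (L : lmodType F)
    (br : L -> L -> L -> L) (V : lmodType F)
    (r m l : L -> L -> V -> V)
    (T : {linear V -> L}) (Tt : nat -> {linear V -> L})
    (L_lts : leibniz_triple_system br)
    (V_rep : representation br r m l)
    (T_rrb : relative_rota_baxter br r m l T)
    (Tt_def : formal_deformation br r m l T Tt) :
  cocycle1 br r m l T (Tt 1%N).
Proof.
case: V_rep => r_tri m_tri l_tri _; case: Tt_def => Tt0 deform u v w.
have := deform u v w 1%N.
rewrite fps_trilin_coef1 !fps_map_const fps_map_coef1 /fps_add !fps_trilin_const_coef1 //.
rewrite !fps_trilin_coef0 !fps_map_const /fps_const /= !Tt0 => first_order.
rewrite /coboundary1.
(* Gather the three brackets in front, so that the first-order equation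
   applies to their sum. *)
set B1 := br _ _ _; set B2 := br _ _ _; set B3 := br _ _ _.
set S1 := T _; set S2 := T _; set S3 := T _; set f0 := Tt 1%N _.
have -> : B1 - S1 + B2 - S2 + B3 - S3 - f0
          = B1 + B2 + B3 - (S1 + S2 + S3 + f0).
  by rewrite !opprD !addrA [LHS](ACl (1*3*5*2*4*6*7)).
rewrite first_order -/f0; apply/eqP; rewrite subr_eq0; apply/eqP.
congr (_ + _); rewrite /S1 /S2 /S3 -!raddfD; congr (T _).
by rewrite !addrA [LHS](ACl (1*3*2*5*4*6)).
Qed.
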